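(* Let $\mathbb{K}$ be a field of characteristic zero and $\mathcal{K}$ a non-empty set of finite groups. Given $G\in\mathcal{K}$, the algebra $\mathrm{End}_{\mathbb{K}\mathcal{S}}(G)=\mathbb{K}\mathcal{S}(G,G)$ is semisimple if and only if $G$ is trivial. In particular, the category algebra $\mathbb{K}\mathcal{S}_{\mathcal{K}}$ is locally semisimple if and only if every group in $\mathcal{K}$ is trivial.
   Context: The subgroup category $\mathcal{S}$ has groups as objects, and the set $\mathcal{S}(R,S)$ of morphisms from $S$ to $R$ is the set of subgroups of $R\times S$ (whose elements are written $r\times s$). The composite of $U\in\mathcal{S}(R,S)$ and $V\in\mathcal{S}(S,T)$ is the star product $U*V\in\mathcal{S}(R,T)$, the subgroup of those $r\times t$ such that there exists $s\in S$ with $r\times s\in U$ and $s\times t\in V$. Morphism sets for distinct pairs of objects are regarded as disjoint. $\mathcal{S}_{\mathcal{K}}$ is the full subcategory with object set $\mathcal{K}$. The category algebra $\mathbb{K}\mathcal{S}_{\mathcal{K}}$ has the set of morphisms of $\mathcal{S}_{\mathcal{K}}$ as a $\mathbb{K}$-basis, with multiplication the $\mathbb{K}$-linear extension of composition, products of non-composable morphisms being zero. $\mathbb{K}\mathcal{S}(G,G)$ is the monoid algebra over $\mathbb{K}$ of the monoid $(\mathcal{S}(G,G),* )$. A ring $A$ (not necessarily unital) is locally unital if every finite subset of $A$ is contained in $eAe$ for some idempotent $e$ of $A$. It is locally semisimple if it is locally unital and the unital ring $eAe$ is semisimple for every idempotent $e$ of $A$. *)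

(* Defs.v *)
From HB Require Import structures.
From mathcomp Require Import all_boot all_order all_algebra all_fingroup finmap.
From mathcomp Require Import monalg.

Set Implicit Arguments.
Unset Strict Implicit.
Unset Printing Implicit Defensive.

Import GRing.Theory.
Local Open Scope ring_scope.

Definition submodule (R : pzRingType) (M : lmodType R) (N : M -> Prop) : Prop :=
  N 0 /\ forall (a : R) (x y : M), N x -> N y -> N (a *: x + y).

Definition semisimple_module (R : pzRingType) (M : lmodType R) : Prop :=
  forall N : M -> Prop, submodule N ->
  exists N' : M -> Prop,
    [/\ submodule N',
        (forall x, N x -> N' x -> x = 0)
      & (forall x, exists y z, [/\ N y, N' z & x = y + z])].

(* Stated for [pzRingType], so that the zero ring (the corner of the
   idempotent 0) is included; it is semisimple. *)
Definition semisimple_ring (R : pzRingType) : Prop := @semisimple_module R R^o.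

HB.mixin Record Zmodule_isRng A & GRing.Zmodule A := {
  rngmul : A -> A -> A;
  rngmulA : associative rngmul;
  rngmulDl : left_distributive rngmul +%R;
  rngmulDr : right_distributive rngmul +%R
}.

#[short(type="rngType")]
HB.structure Definition Rng := {A of GRing.Zmodule A & Zmodule_isRng A}.

Local Notation "x ** y" := (rngmul x y) (at level 40, left associativity).

Record idempotent_of (A : rngType) :=
  Idempotent { idem_val :> A; idemP : idem_val ** idem_val = idem_val }.

Section Corner.
Variables (A : rngType) (e : idempotent_of A).

Definition corner : {pred A} := [pred x : A | (e : A) ** x ** (e : A) == x].

Lemma cornerP (x : A) :
  reflect (exists a : A, x = (e : A) ** a ** (e : A)) (x \in corner).
Proof.
apply: (iffP eqP) => [<-|[a ->]]; first by exists x.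
by rewrite !rngmulA idemP -!rngmulA idemP.
Qed.

Lemma corner_zmod_closed : zmod_closed corner.
Proof.
split=> [|x y]; rewrite !inE.
  have z_e (z : A) : z ** 0 = 0.
    by apply: (addrI (z ** 0)); rewrite -rngmulDr !addr0.
  have e_z (z : A) : 0 ** z = 0.
    by apply: (addrI (0 ** z)); rewrite -rngmulDl !addr0.
  by rewrite z_e e_z.
move=> /eqP xe /eqP ye; apply/eqP; apply: (addIr y); rewrite subrK.
by rewrite -{2}ye -rngmulDl -rngmulDr subrK.
Qed.

HB.instance Definition _ :=
  GRing.isZmodClosed.Build A corner corner_zmod_closed.

Record corner_ring :=
  Corner { corner_val :> A; cornerK : corner_val \in corner }.

HB.instance Definition _ := [isSub for corner_val].
HB.instance Definition _ := [Choice of corner_ring by <:].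
HB.instance Definition _ := [SubChoice_isSubZmodule of corner_ring by <:].

Lemma corner1_subproof : (e : A) \in corner.
Proof. by rewrite inE !idemP. Qed.

Lemma cornerM_subproof (x y : corner_ring) : (x : A) ** (y : A) \in corner.
Proof.
case: x y => x /= /cornerP[a ->] [y /= /cornerP[b ->]].
by apply/cornerP; exists (a ** e ** (e ** b)); rewrite !rngmulA.
Qed.

Definition corner1 : corner_ring := Corner corner1_subproof.
Definition cornerM (x y : corner_ring) : corner_ring :=
  Corner (cornerM_subproof x y).

Lemma cornerMA : associative cornerM.
Proof. by move=> x y z; apply: val_inj; rewrite /= rngmulA. Qed.

Lemma corner1M : left_id corner1 cornerM.
Proof.
move=> [x xP]; apply: val_inj; rewrite /=; case/cornerP: xP => a ->.
by rewrite !rngmulA idemP.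
Qed.

Lemma cornerM1 : right_id corner1 cornerM.
Proof.
move=> [x xP]; apply: val_inj; rewrite /=; case/cornerP: xP => a ->.
by rewrite -!rngmulA idemP.
Qed.

Lemma cornerMDl : left_distributive cornerM +%R.
Proof. by move=> x y z; apply: val_inj; rewrite /= rngmulDl. Qed.

Lemma cornerMDr : right_distributive cornerM +%R.
Proof. by move=> x y z; apply: val_inj; rewrite /= rngmulDr. Qed.

HB.instance Definition _ := GRing.Zmodule_isPzRing.Build corner_ring
  cornerMA corner1M cornerM1 cornerMDl cornerMDr.

End Corner.

Definition locally_unital (A : rngType) : Prop :=
  forall s : seq A, exists e : idempotent_of A, {subset s <= corner e}.

Definition locally_semisimple (A : rngType) : Prop :=
  locally_unital A /\ forall e : idempotent_of A, semisimple_ring (corner_ring e).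

Section Lift.
Variables (K : fieldType) (T : choiceType) (V : lmodType K).
Implicit Types (h : T -> V) (a b : {malg K[T]}).

Definition lin_ext h a : V := \sum_(f <- msupp a) a@_f *: h f.

Lemma lin_ext_w h a (d : {fset T}) :
  (msupp a `<=` d)%fset -> lin_ext h a = \sum_(f <- d) a@_f *: h f.
Proof.
move=> ad; rewrite /lin_ext; apply: big_fset_incl => // f _ /mcoeff_outdom ->.
by rewrite scale0r.
Qed.

Lemma lin_extP h (c : K) a b : lin_ext h (c *: a + b) = c *: lin_ext h a + lin_ext h b.
Proof.
pose d := (msupp a `|` msupp b `|` msupp (c *: a + b))%fset.
rewrite (@lin_ext_w h a d) ?(@lin_ext_w h b d) ?(@lin_ext_w h _ d).
- rewrite scaler_sumr -big_split; apply: eq_bigr => f _ /=.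
  by rewrite mcoeffD mcoeffZ scalerDl scalerA.
- by rewrite /d fsubsetUr.
- by rewrite /d -fsetUA fsetUCA fsubsetUl.
- by rewrite /d -fsetUA fsubsetUl.
Qed.

Lemma lin_ext_is_linear h : linear (lin_ext h).
Proof. by move=> c a b; apply: lin_extP. Qed.

HB.instance Definition _ h :=
  GRing.isLinear.Build K {malg K[T]} V _ (lin_ext h) (lin_ext_is_linear h).

Lemma lin_extU h f : lin_ext h << f >> = h f.
Proof.
rewrite (@lin_ext_w _ _ [fset f]%fset) ?msuppU_le //.
by rewrite big_seq_fset1 mcoeffUU scale1r.
Qed.

Lemma lin_ext_uniq (u v : {malg K[T]} -> V) :
  linear u -> linear v -> (forall f, u << f >> = v << f >>) -> u =1 v.
Proof.
move=> lu lv uv a; pose u' : {linear _ -> _} := HB.pack u (GRing.isLinear.Build _ _ _ _ u lu).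
pose v' : {linear _ -> _} := HB.pack v (GRing.isLinear.Build _ _ _ _ v lv).
rewrite -[u]/(u' : _ -> _) -[v]/(v' : _ -> _).
rewrite (monalgE a) !linear_sum; apply: eq_bigr => f _.
have -> : << a@_f *g f >> = a@_f *: << f >> :> {malg K[T]}.
  by apply/malgP => g; rewrite mcoeffZ !mcoeffU mulrnAr mulr1.
by rewrite !linearZ /= uv.
Qed.

End Lift.

Section Bilin.
Variables (K : fieldType) (T : choiceType) (m : T -> T -> {malg K[T]}).
Implicit Types a b c : {malg K[T]}.

(* The bilinear map on the free module over [T] sending a pair of basis
   vectors [(<< f >>, << g >>)] to [m f g]. *)
Definition bilin a b : {malg K[T]} := lin_ext (fun f => lin_ext (m f) b) a.

Lemma bilinPl b : linear (bilin^~ b).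
Proof. by move=> k a a'; rewrite /bilin linearP. Qed.

Lemma bilinPr a : linear (bilin a).
Proof.
move=> k b b'; rewrite /bilin /lin_ext scaler_sumr -big_split.
apply: eq_bigr => f _ /=; rewrite -!/(lin_ext (m f) _) linearP scalerDr.
by rewrite !scalerA mulrC.
Qed.

Lemma bilinDl : left_distributive bilin +%R.
Proof. by move=> a b c; have := bilinPl c 1 a b; rewrite !scale1r. Qed.

Lemma bilinDr : right_distributive bilin +%R.
Proof. by move=> a b c; have := bilinPr a 1 b c; rewrite !scale1r. Qed.

Lemma bilinUU f g : bilin << f >> << g >> = m f g.
Proof. by rewrite /bilin !lin_extU. Qed.

Lemma bilinA :
  (forall f g h, bilin << f >> (m g h) = bilin (m f g) << h >>) ->
  associative bilin.
Proof.
move=> mA a b c.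
apply: (@lin_ext_uniq _ _ _ (fun a => bilin a (bilin b c))
          (fun a => bilin (bilin a b) c)) => [||f].
- exact: bilinPl.
- by move=> k x y; rewrite !bilinPl.
apply: (@lin_ext_uniq _ _ _ (fun b => bilin << f >> (bilin b c))
          (fun b => bilin (bilin << f >> b) c)) => [||g].
- by move=> k x y; rewrite bilinPl bilinPr.
- by move=> k x y; rewrite bilinPr bilinPl.
apply: (@lin_ext_uniq _ _ _ (fun c => bilin << f >> (bilin << g >> c))
          (bilin (bilin << f >> << g >>))) => [||h].
- by move=> k x y; rewrite !bilinPr.
- exact: bilinPr.
by rewrite !bilinUU mA.
Qed.

End Bilin.

(* [{group (gR * gS)}] is the set of morphisms from [gS] to [gR]. *)

Section Star.
Variables gR gS gT : finGroupType.
Variables (U : {group (gR * gS)}) (V : {group (gS * gT)}).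

Definition star_set : {set gR * gT} :=
  [set rt | [exists s : gS, ((rt.1, s) \in U) && ((s, rt.2) \in V)]].

Lemma star_group_set : group_set star_set.
Proof.
apply/group_setP; split=> [|[r t] [r' t']].
  rewrite inE; apply/existsP; exists 1%g.
  by rewrite (group1 U) (group1 V).
rewrite !inE /= => /existsP[s /andP[Us Vs]] /existsP[s' /andP[Us' Vs']].
apply/existsP; exists (s * s')%g.
by rewrite (groupM Us Us') (groupM Vs Vs').
Qed.

Definition star : {group (gR * gT)} := Group star_group_set.

Lemma starP r t :
  reflect (exists s, (r, s) \in U /\ (s, t) \in V) ((r, t) \in star).
Proof.
rewrite inE; apply: (iffP existsP) => [[s /andP[]]|[s []]]; first by exists s.
by move=> Us Vs; exists s; rewrite Us.
Qed.

End Star.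

Lemma starA (gQ gR gS gT : finGroupType) (U : {group (gQ * gR)})
    (V : {group (gR * gS)}) (W : {group (gS * gT)}) :
  star U (star V W) = star (star U V) W.
Proof.
apply/group_inj/setP=> -[q t]; apply/starP/starP.
  move=> [r [Ur /starP[s [Vs Ws]]]]; exists s; split=> //.
  by apply/starP; exists r.
move=> [s [/starP[r [Ur Vs]] Ws]]; exists r; split=> //.
by apply/starP; exists s.
Qed.

Section Diag.
Variable gG : finGroupType.

Definition diag_set : {set gG * gG} := [set x | x.1 == x.2].

Lemma diag_group_set : group_set diag_set.
Proof.
apply/group_setP; split=> [|[x1 x2] [y1 y2]]; rewrite !inE //=.
by move=> /eqP-> /eqP->.
Qed.

(* The identity morphism of [gG]. *)
Definition diag_subgroup : {group (gG * gG)} := Group diag_group_set.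

End Diag.

Lemma star1U (gR gS : finGroupType) (U : {group (gR * gS)}) :
  star (diag_subgroup gR) U = U.
Proof.
apply/group_inj/setP=> -[r s]; apply/starP/idP => [[r' []]|Urs].
  by rewrite inE /= => /eqP->.
by exists r; rewrite inE /=.
Qed.

Lemma starU1 (gR gS : finGroupType) (U : {group (gR * gS)}) :
  star U (diag_subgroup gS) = U.
Proof.
apply/group_inj/setP=> -[r s]; apply/starP/idP => [[s' [Urs]]|Urs].
  by rewrite inE /= => /eqP<-.
by exists s; rewrite inE /=.
Qed.

Section EndAlgebra.
Variables (K : fieldType) (gG : finGroupType).

(* A definition rather than a notation: the multiplication that [monalg] puts
   on [{malg K[M]}] is only available when 1 is the sole unit of [M]. *)
Definition end_algebra := {malg K[{group (gG * gG)}]}.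

HB.instance Definition _ :=
  GRing.Lmodule.copy end_algebra {malg K[{group (gG * gG)}]}.

Definition end_mul : end_algebra -> end_algebra -> end_algebra :=
  bilin (fun U V => << star U V >>).

Definition end_one : end_algebra := << diag_subgroup gG >>.

Lemma end_mulA : associative end_mul.
Proof. by apply: bilinA => U V W; rewrite !bilinUU starA. Qed.

Lemma end_mul1 : left_id end_one end_mul.
Proof.
apply: (@lin_ext_uniq _ _ _ (end_mul end_one) id) => [||U].
- exact: bilinPr.
- by [].
by rewrite /end_mul bilinUU star1U.
Qed.

Lemma end_mulr1 : right_id end_one end_mul.
Proof.
apply: (@lin_ext_uniq _ _ _ (end_mul^~ end_one) id) => [||U].
- exact: bilinPl.
- by [].
by rewrite /end_mul bilinUU starU1.
Qed.

Lemma end_mulDl : left_distributive end_mul +%R.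
Proof. exact: bilinDl. Qed.

Lemma end_mulDr : right_distributive end_mul +%R.
Proof. exact: bilinDr. Qed.

HB.instance Definition _ := GRing.Zmodule_isPzRing.Build end_algebra
  end_mulA end_mul1 end_mulr1 end_mulDl end_mulDr.

End EndAlgebra.

(* The set of groups is given as a family [G] indexed by a type of objects
   [I].  Since morphisms carry their domain and codomain, morphism sets for
   distinct pairs of objects are disjoint. *)

Section CategoryAlgebra.
Variables (K : fieldType) (I : choiceType) (G : I -> finGroupType).

(* [existT _ (r, s) U] is the morphism from [G s] to [G r] given by
   [U <= G r * G s]. *)
Definition sub_mor : choiceType := {p : I * I & {group (G p.1 * G p.2)}}.

Definition mor (r s : I) (U : {group (G r * G s)}) : sub_mor :=
  existT (fun p => {group (G p.1 * G p.2)}) (r, s) U.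

Definition cast_cod (s s' t : I) (e : s' = s) (V : {group (G s' * G t)}) :
    {group (G s * G t)} :=
  ecast i {group (G i * G t)} e V.

(* The composite of [f] and [g], or 0 if they are not composable. *)
Definition mor_mul (f g : sub_mor) : {malg K[sub_mor]} :=
  let: existT (r, s) U := f in
  let: existT (s', t) V := g in
  if s' =P s is ReflectT e then << mor (star U (cast_cod e V)) >> else 0.

Lemma mor_mulE r s t (U : {group (G r * G s)}) (V : {group (G s * G t)}) :
  mor_mul (mor U) (mor V) = << mor (star U V) >>.
Proof.
rewrite /mor_mul /mor; case: (s =P s) => [e|ns]; last by case: ns.
have -> : e = erefl by apply: eq_axiomK.
exact: erefl.
Qed.

Lemma mor_mul_neq r s s' t (U : {group (G r * G s)}) (V : {group (G s' * G t)}) :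
  s' != s -> mor_mul (mor U) (mor V) = 0.
Proof. by rewrite /mor_mul /=; case: eqP. Qed.

Definition category_algebra := {malg K[sub_mor]}.

HB.instance Definition _ := 
  GRing.Lmodule.copy category_algebra {malg K[sub_mor]}.

Definition cat_mul : category_algebra -> category_algebra -> category_algebra :=
  bilin mor_mul.

Lemma cat_mulA : associative cat_mul.
Proof.
apply: bilinA => -[[q r] U] [[r' s] V] [[s' t] W].
rewrite -!/(mor _).
have bil0 (x : {malg K[sub_mor]}) : bilin mor_mul x 0 = 0.
  by apply: (addrI (bilin mor_mul x 0)); rewrite -bilinDr !addr0.
have b0il (x : {malg K[sub_mor]}) : bilin mor_mul 0 x = 0.
  by apply: (addrI (bilin mor_mul 0 x)); rewrite -bilinDl !addr0.
have [es|ns] := eqVneq s' s; last first.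
  rewrite (mor_mul_neq V W ns) bil0.
  have [er|nr] := eqVneq r' r; last by rewrite mor_mul_neq // b0il.
  by subst r'; rewrite mor_mulE bilinUU mor_mul_neq.
subst s'; rewrite mor_mulE bilinUU.
have [er|nr] := eqVneq r' r; last by rewrite !mor_mul_neq // b0il.
by subst r'; rewrite !mor_mulE bilinUU mor_mulE starA.
Qed.

Lemma cat_mulDl : left_distributive cat_mul +%R.
Proof. exact: bilinDl. Qed.

Lemma cat_mulDr : right_distributive cat_mul +%R.
Proof. exact: bilinDr. Qed.

HB.instance Definition _ := Zmodule_isRng.Build category_algebra
  cat_mulA cat_mulDl cat_mulDr.

End CategoryAlgebra.

(* Main.v *)
Require Import Defs.
From Stdlib Require Import Classical.
From HB Require Import structures.
From mathcomp Require Import all_boot all_order all_algebra all_fingroup.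
From mathcomp Require Import finmap monalg.

Set Implicit Arguments.
Unset Strict Implicit.
Unset Printing Implicit Defensive.

Import GRing.Theory.
Local Open Scope ring_scope.

(** The idea is that products of subgroups A x B are invisible from inside:
    [(A x B) * U * (C x D) = A x D] for every U, because every subgroup
    contains the identity ([star_setX]).  Hence [x = (1 x 1) - (1 x G)]
    satisfies [x a x = 0] for all a: each of the four terms of
    [x U x] is determined by its right-hand factor alone, and they cancel in
    pairs ([bilin_sandwich0]).  A semisimple ring has no nonzero x with
    [x R x = 0], since the left ideal R x would have square zero
    ([semisimple_sandwich0]).  So semisimplicity forces [1 x 1 = 1 x G], that
    is, G trivial.  In the category algebra the same element lies in the corner
    of the identity morphism of G, and the same computation applies.

    Conversely, when all groups are trivial there is exactly one morphism
    between any two objects, so the category algebra is the algebra of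
    matrices indexed by the objects with finitely many nonzero entries.
    Finitely many elements live in the matrices over a finite set F of objects,
    whose identity matrix is a local unit.  For an idempotent e over F, the
    corner e A e is e M e, with M the full matrix algebra over F.
    [matrix_corner_semisimple] shows such rings semisimple: they are von Neumann
    regular, because a generalized inverse of a matrix in e M e can be
    compressed to the corner; regularity lets an idempotent of a left ideal N
    grow until it is a right unit for N, the growth being bounded by the matrix
    rank; and a left ideal with such an idempotent is a direct summand.
    The algebra of a single trivial group is the case of 1 x 1 matrices. *)

(** * Semisimple rings *)

(** Write [1 = y + z] along a decomposition of R into R x and a complement.
    Then [x = x y + x z] and [x y] lies in [x R x = 0], so x is in the
    complement as well as in R x. *)
Lemma semisimple_sandwich0 (R : pzRingType) (x : R) :
  semisimple_ring R -> (forall a, x * a * x = 0) -> x = 0.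
Proof.
move=> ssR xRx; pose N (y : R^o) := exists a : R, y = a * x.
have subN : submodule N.
  split=> [|c y z [a ->] [b ->]]; first by exists 0; rewrite mul0r.
  by exists (c * a + b); rewrite mulrDl -mulrA.
have [N' [[N'0 subN'] NN' decomp]] := ssR N subN.
have [y [z [[a defy] N'z def1]]] := decomp (1 : R).
have xz : x = x * z by rewrite -[LHS]mulr1 [1]def1 mulrDr defy mulrA xRx add0r.
apply: NN'; first by exists 1; rewrite mul1r.
by rewrite xz; have := subN' x z 0 N'z N'0; rewrite addr0.
Qed.

(** Such an f is idempotent, so right multiplication by f projects R onto N;
    the complement is the kernel of this projection. *)
Lemma semisimple_left_ideal_unit (R : pzRingType) :
  (forall N : R^o -> Prop, submodule N ->
     exists2 f, N f & forall x : R, N x -> x * f = x) ->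
  semisimple_ring R.
Proof.
move=> unitN N subN; have [f Nf xf] := unitN N subN; have [N0 NZ] := subN.
exists (fun y : R => y * f = 0); split=> [|x /xf-> //|x].
  split=> [|a y z yf zf]; first exact: mul0r.
  by rewrite mulrDl -[a *: y]/(a * y) -mulrA yf zf mulr0 addr0.
exists (x * f), (x - x * f); split; last by rewrite addrC subrK.
  by have := NZ x f 0 Nf N0; rewrite addr0.
by rewrite mulrBl -mulrA (xf f) // subrr.
Qed.

Section MatrixCorner.
Variables (K : fieldType) (n : nat).

(** The row space of f is contained in that of f + h; if they were equal, f
    would fix the rows of h, whereas it kills them. *)
Lemma mxrank_orthogonal_idempotents (f h : 'M[K]_n) :
  f *m f = f -> h *m h = h -> f *m h = 0 -> h *m f = 0 -> h != 0 ->
  (\rank f < \rank (f + h)%R)%N.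
Proof.
move=> ff hh fh hf; apply: contraNT; rewrite -leqNgt => le_rank.
have sub_f : (f <= (f + h)%R)%MS.
  by apply/submxP; exists f; rewrite mulmxDr ff fh addr0.
have sub_fh : ((f + h)%R <= f)%MS.
  by rewrite -(mxrank_leqif_sup sub_f) eqn_leq le_rank mxrankS.
have /submxP[D defh] : (h <= f)%MS.
  apply: submx_trans sub_fh; apply/submxP; exists h.
  by rewrite mulmxDr hf hh add0r.
by rewrite -hf {2}defh -mulmxA ff -defh.
Qed.

(* A ring identified by phi with the corner of the idempotent phi 1 in the
   matrix ring; phi need not preserve the unit. *)
Variables (R : pzRingType) (phi : R -> 'M[K]_n).
Hypotheses (phiD : {morph phi : x y / x + y})
           (phiM : forall x y, phi (x * y) = phi x *m phi y)
           (phi_inj : injective phi)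
           (phi_corner : forall M, exists r, phi r = phi 1 *m M *m phi 1).

(** Compressing a generalized inverse M of [phi y] to the corner does not
    change [phi y *m M *m phi y], since [phi 1] fixes [phi y] on both sides. *)
Lemma matrix_corner_regular (y : R) : exists b, y * b * y = y.
Proof.
have pinvK : phi y *m pinvmx (phi y) *m phi y = phi y by exact: mulmxKpV.
have [b defb] := phi_corner (pinvmx (phi y)); exists b; apply: phi_inj.
rewrite -[RHS]pinvK !phiM defb; move: (pinvmx _) => M.
by rewrite !mulmxA -phiM mulr1 -(mulmxA _ (phi 1)) -phiM mul1r.
Qed.

(** If f misses some x in N, then [y = x - x f] is a nonzero element of N with
    [y f = 0].  Regularity turns it into an idempotent g with [y g = y] and
    [g f = 0]; subtracting [f g] makes it orthogonal to f on both sides. *)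
Lemma matrix_corner_idempotent_grow (N : R^o -> Prop) (f : R) :
  submodule N -> N f -> f * f = f ->
  (forall x : R, N x -> x * f = x) \/
  exists f' : R, [/\ N f', f' * f' = f' & (\rank (phi f) < \rank (phi f'))%N].
Proof.
move=> [N0 NZ] Nf ff.
have NM a (x : R) : N x -> N (a * x).
  by move=> Nx; have := NZ a x 0 Nx N0; rewrite addr0.
have ND (x y : R) : N x -> N y -> N (x + y).
  by move=> Nx Ny; have := NZ 1 x y Nx Ny; rewrite scale1r.
have NB (x y : R) : N x -> N y -> N (x - y).
  by move=> Nx Ny; apply: ND => //; rewrite -mulN1r; apply: NM.
have phi0 : phi 0 = 0 by apply: (addrI (phi 0)); rewrite -phiD !addr0.
have [|unstable] := classic (forall x : R, N x -> x * f = x); first by left.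
have [x xP] := not_all_ex_not _ _ unstable; right.
have [Nx /eqP xf] := imply_to_and _ _ xP.
pose y := x - x * f.
have y0 : y != 0 by rewrite subr_eq0 eq_sym.
have Ny : N y by apply: NB => //; apply: NM.
have yf : y * f = 0 by rewrite mulrBl -mulrA ff subrr.
have [b yby] := matrix_corner_regular y.
(* g generates the left ideal R y, and h is its correction orthogonal to f. *)
pose g := b * y; pose h := g - f * g.
have yg : y * g = y by rewrite /g mulrA.
have gg : g * g = g by rewrite {1}/g -mulrA yg.
have gf : g * f = 0 by rewrite -mulrA yf mulr0.
have hf : h * f = 0 by rewrite mulrBl -(mulrA f) gf mulr0 subrr.
have fh : f * h = 0 by rewrite mulrBr (mulrA f f) ff subrr.
have yh : y * h = y by rewrite mulrBr yg (mulrA y f) yf mul0r subr0.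
have gh : g * h = g by rewrite -mulrA yh.
have hh : h * h = h by rewrite {1}/h mulrBl -(mulrA f) gh.
have h0 : h != 0 by apply: contra_neq y0 => h0; rewrite -yh h0 mulr0.
exists (f + h); split.
- by apply: ND => //; apply: NB; rewrite ?mulrA; do ?apply: NM.
- by rewrite mulrDl (mulrDr f f) (mulrDr h f) ff fh hf hh addr0 add0r.
rewrite phiD; apply: mxrank_orthogonal_idempotents; rewrite -?phiM.
- by rewrite ff.
- by rewrite hh.
- by rewrite fh.
- by rewrite hf.
by apply: contra_neq h0 => h0; apply: phi_inj; rewrite h0 phi0.
Qed.

Lemma matrix_corner_semisimple : semisimple_ring R.
Proof.
apply: semisimple_left_ideal_unit => N subN.
have climb k (f : R) : N f -> f * f = f -> (n - \rank (phi f) <= k)%N ->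
    exists2 f', N f' & forall x : R, N x -> x * f' = x.
  elim: k f => [|k IHk] f Nf ff rank_f.
    have [fP|[f' [_ _]]] := matrix_corner_idempotent_grow subN Nf ff.
      by exists f.
    move=> /leq_trans/(_ (rank_leq_row _)).
    by rewrite -subn_gt0 ltnNge rank_f.
  have [fP|[f' [Nf' ff' lt_rank]]] := matrix_corner_idempotent_grow subN Nf ff.
    by exists f.
  apply: (IHk f') => //; rewrite -ltnS; apply: leq_trans rank_f.
  by apply: ltn_sub2l => //; apply: leq_trans lt_rank (rank_leq_row _).
by have [N0 _] := subN; apply: (climb n 0); rewrite ?mulr0 ?leq_subr.
Qed.

End MatrixCorner.

(** * Bilinear products on a free module *)

Section BilinearExpansion.
Variables (K : fieldType) (T : choiceType) (m : T -> T -> {malg K[T]}).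
Implicit Types a b : {malg K[T]}.

Lemma bilin0l b : bilin m 0 b = 0.
Proof. by apply: (addrI (bilin m 0 b)); rewrite -bilinDl !addr0. Qed.

Lemma bilinBl a a' b :
  bilin m (a - a') b = bilin m a b - bilin m a' b.
Proof. by apply: (addIr (bilin m a' b)); rewrite -bilinDl !subrK. Qed.

Lemma bilinBr a b b' :
  bilin m a (b - b') = bilin m a b - bilin m a b'.
Proof. by apply: (addIr (bilin m a b')); rewrite -bilinDr !subrK. Qed.

Lemma bilin0r a : bilin m a 0 = 0.
Proof. by apply: (addrI (bilin m a 0)); rewrite -bilinDr !addr0. Qed.

Lemma bilinZl c a b : bilin m (c *: a) b = c *: bilin m a b.
Proof. by have := bilinPl m b c a 0; rewrite bilin0l !addr0. Qed.

Lemma bilinZr c a b : bilin m a (c *: b) = c *: bilin m a b.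
Proof. by have := bilinPr m a c b 0; rewrite bilin0r !addr0. Qed.

Lemma bilin_suml (J : finType) (x : J -> {malg K[T]}) b :
  bilin m (\sum_j x j) b = \sum_j bilin m (x j) b.
Proof.
apply: (big_morph (fun a => bilin m a b)) => [a a'|].
  exact: bilinDl.
exact: bilin0l.
Qed.

Lemma bilin_sumr (J : finType) a (x : J -> {malg K[T]}) :
  bilin m a (\sum_j x j) = \sum_j bilin m a (x j).
Proof. by apply: big_morph => [b b'|]; [exact: bilinDr|exact: bilin0r]. Qed.

Lemma mcoeff_bilin a b (f : T) :
  (bilin m a b)@_f =
  \sum_(g <- msupp a) a@_g * \sum_(h <- msupp b) b@_h * (m g h)@_f.
Proof.
rewrite /bilin /lin_ext raddf_sum; apply: eq_bigr => g _ /=.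
rewrite mcoeffZ raddf_sum; congr (_ * _); apply: eq_bigr => h _ /=.
by rewrite mcoeffZ.
Qed.

(** The hypothesis says that y f z does not depend on y, so that already
    [(p - q) f] is annihilated by p and q on the right. *)
Lemma bilin_sandwich0 (p q : T) (c : T -> K) a :
  (forall f y z, y \in [:: p; q] -> z \in [:: p; q] ->
     bilin m (m y f) << z >> = c f *: << z >>) ->
  bilin m (bilin m (<< p >> - << q >>) a) (<< p >> - << q >>) = 0.
Proof.
move=> sandw.
apply: (@lin_ext_uniq _ _ _
  (fun a => bilin m (bilin m (<< p >> - << q >>) a) (<< p >> - << q >>))
  (fun=> 0)) => [||f].
- by move=> k u v; rewrite bilinPr bilinPl.
- by move=> k u v; rewrite scaler0 addr0.
have pP : p \in [:: p; q] by rewrite mem_head.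
have qP : q \in [:: p; q] by rewrite !inE eqxx orbT.
rewrite bilinBr !bilinBl !bilinUU.
rewrite (sandw f p p) // (sandw f q p) // (sandw f p q) // (sandw f q q) //.
by rewrite !subrr.
Qed.

Lemma basis_eq (p q : T) :
  << p >> - << q >> = 0 :> {malg K[T]} -> p = q.
Proof.
move/eqP; rewrite subr_eq0 => /eqP/(congr1 (mcoeff p)).
rewrite !mcoeffU eqxx [q == p]eq_sym; case: eqP => // _ /eqP.
by rewrite oner_eq0.
Qed.

End BilinearExpansion.

(** * A nontrivial group obstructs semisimplicity *)

Section Sandwich.
Variables (K : fieldType).

(** The identity of the middle groups relates every element of A to every
    element of D. *)
Lemma star_setX (gQ gR gS gT : finGroupType) (A : {group gQ}) (B : {group gR})
    (C : {group gS}) (D : {group gT}) (U : {group (gR * gS)}) :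
  star (star (setX_group A B) U) (setX_group C D) = setX_group A D.
Proof.
apply/group_inj/setP=> -[r s]; rewrite [RHS]in_setX.
apply/starP/andP => [[t [/starP[t' []]]]|[Ar Ds]].
  by rewrite !in_setX => /andP[Ar _] _ /andP[_ Ds].
exists 1%g; split; last by rewrite in_setX group1.
by apply/starP; exists 1%g; rewrite in_setX Ar !group1.
Qed.

Lemma trivial_of_setX (gG : finGroupType) :
  setX_group 1 1 = setX_group 1 [set: gG] :> {group (gG * gG)} ->
  [set: gG] = [set 1%g].
Proof.
move=> eqX; apply/setP=> g; rewrite in_setT in_set1.
have : ((1%g : gG), g) \in setX_group 1 [set: gG] by rewrite in_setX group1 inE.
by rewrite -eqX in_setX => /andP[_ /set1P->]; rewrite eqxx.
Qed.

Lemma end_algebra_trivial (gG : finGroupType) :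
  semisimple_ring (end_algebra K gG) -> [set: gG] = [set 1%g].
Proof.
move=> ss; apply: trivial_of_setX; apply: basis_eq.
apply: (semisimple_sandwich0 ss) => a.
apply: (@bilin_sandwich0 _ _ _ _ _ (fun=> 1)) => U V W.
rewrite !inE scale1r bilinUU.
by move=> /orP[]/eqP-> /orP[]/eqP->; rewrite star_setX.
Qed.

(** Fixes the type of a basis vector to be the category algebra rather than the
    underlying free module, so that its ring structure is found. *)
Definition cat_elt (I : choiceType) (G : I -> finGroupType) (f : sub_mor G) :
  category_algebra K G := << f >>.

Lemma cat_eltM (I : choiceType) (G : I -> finGroupType) r s t
    (U : {group (G r * G s)}) (V : {group (G s * G t)}) :
  rngmul (cat_elt (mor U)) (cat_elt (mor V)) = cat_elt (mor (star U V)).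
Proof. by rewrite /cat_elt -mor_mulE -bilinUU. Qed.

(** The morphisms f from i to i are absorbed by [star_setX]; all others give a
    zero product.  The scalar c tells the two cases apart. *)
Lemma category_sandwich0 (I : choiceType) (G : I -> finGroupType) (i : I)
    (A B C : {group G i}) (a : {malg K[sub_mor G]}) :
  bilin (@mor_mul K I G)
    (bilin (@mor_mul K I G)
      (<< mor (setX_group A B) >> - << mor (setX_group A C) >>) a)
    (<< mor (setX_group A B) >> - << mor (setX_group A C) >>) = 0.
Proof.
pose c (f : sub_mor G) : K := ((tag f).1 == i)%:R * ((tag f).2 == i)%:R.
apply: (@bilin_sandwich0 K (sub_mor G) (@mor_mul K I G)
  (mor (setX_group A B)) (mor (setX_group A C)) c a).
move=> [[r s] U] V W.
rewrite -/(mor U) !inE => VP WP.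
have [V' defV] : exists V' : {group G i}, V = mor (setX_group A V').
  by case/orP: VP => /eqP->; [exists B|exists C].
have [W' defW] : exists W' : {group G i}, W = mor (setX_group A W').
  by case/orP: WP => /eqP->; [exists B|exists C].
rewrite {}defV {}defW.
have -> : c (mor U) = (r == i)%:R * (s == i)%:R by [].
have [er|nr] := eqVneq r i; last first.
  by rewrite mor_mul_neq // mul0r scale0r bilin0l.
subst r; rewrite mor_mulE bilinUU mul1r.
have [es|ns] := eqVneq s i; last by rewrite mor_mul_neq 1?eq_sym // scale0r.
by subst s; rewrite mor_mulE star_setX scale1r.
Qed.

(** The element of [category_sandwich0] is nonzero unless G i is trivial, and
    lies in the corner of the identity morphism of G i. *)
Lemma cat_algebra_trivial (I : choiceType) (G : I -> finGroupType) (i : I) :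
  (forall e : idempotent_of (category_algebra K G),
     semisimple_ring (corner_ring e)) ->
  [set: G i] = [set 1%g].
Proof.
pose u := cat_elt (mor (diag_subgroup (G i))).
have uu : rngmul u u = u by rewrite cat_eltM star1U.
pose e := Idempotent uu.
have e_mor (U : {group (G i * G i)}) : cat_elt (mor U) \in corner e.
  have uU : rngmul u (cat_elt (mor U)) = cat_elt (mor U).
    exact: etrans (cat_eltM _ _) (congr1 (fun V => cat_elt (mor V)) (star1U U)).
  have Uu : rngmul (cat_elt (mor U)) u = cat_elt (mor U).
    exact: etrans (cat_eltM _ _) (congr1 (fun V => cat_elt (mor V)) (starU1 U)).
  by apply/eqP; apply: etrans (congr1 (rngmul^~ u) uU) Uu.
move=> /(_ e) ss; apply: trivial_of_setX.
set P := setX_group _ _; set Q := setX_group _ _.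
pose x := cat_elt (mor P) - cat_elt (mor Q).
have x_corner : x \in corner e by apply: rpredB; apply: e_mor.
have x0 : x = 0.
  suff /(congr1 (@corner_val _ _)) : Corner x_corner = 0 by [].
  apply: (semisimple_sandwich0 ss) => a; apply: val_inj.
  exact: category_sandwich0.
have /eqP := basis_eq x0.
by rewrite eq_Tagged => /eqP.
Qed.

End Sandwich.

(** * Trivial groups give matrix algebras *)

Section TrivialGroups.
Variables (K : fieldType) (I : choiceType) (G : I -> finGroupType).
Hypothesis G1 : forall i, [set: G i] = [set 1%g].
Local Notation A := (category_algebra K G).

Definition elem (r s : I) : sub_mor G := mor (1%G : {group G r * G s}).

Lemma trivial_group_subgroup (gR gS : finGroupType) (U : {group (gR * gS)}) :
  [set: gR] = [set 1%g] -> [set: gS] = [set 1%g] -> U = 1%G.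
Proof.
move=> R1 S1; apply/group_inj/eqP; rewrite eqEsubset sub1G andbT.
apply/subsetP=> -[r s] _.
have /set1P-> : r \in [set 1%g] by rewrite -R1 inE.
have /set1P-> : s \in [set 1%g] by rewrite -S1 inE.
exact: group1.
Qed.

Lemma mor_elem (f : sub_mor G) : f = elem (tag f).1 (tag f).2.
Proof.
case: f => -[r s] U; rewrite /elem /mor /=; congr existT.
exact: trivial_group_subgroup.
Qed.

Lemma elem_eq r s r' s' : (elem r s == elem r' s') = (r == r') && (s == s').
Proof.
by apply/eqP/andP => [/(congr1 tag)[-> ->]|[/eqP-> /eqP->]].
Qed.

Lemma mor_mul_elem r s s' t :
  mor_mul K (elem r s) (elem s' t) = << elem r t >> *+ (s == s').
Proof.
have [<-|ns] := eqVneq s s'; last by rewrite mor_mul_neq // eq_sym.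
rewrite mor_mulE; congr << mor _ >>; exact: trivial_group_subgroup.
Qed.

(** The matrix unit at position (r, s). *)
Definition unit_elt (r s : I) : A := cat_elt K (elem r s).

Lemma unit_eltM r s s' t :
  rngmul (unit_elt r s) (unit_elt s' t) = if s == s' then unit_elt r t else 0.
Proof.
rewrite /rngmul /= /cat_mul bilinUU mor_mul_elem /unit_elt /cat_elt.
by case: (s == s'); rewrite ?mulr1n ?mulr0n.
Qed.

Section Matrices.
Variable F : {fset I}.

Definition pt (i : 'I_#|{: F}|) : I := val (enum_val i).

Lemma pt_inj : injective pt.
Proof. by move=> i j /val_inj/enum_val_inj. Qed.

Lemma pt_surj (r : I) : r \in F -> exists i, pt i = r.
Proof.
by move=> rF; exists (enum_rank [` rF]%fset); rewrite /pt enum_rankK.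
Qed.

Lemma pt_in i : pt i \in F.
Proof. exact: valP. Qed.

Definition coef_mx (a : A) : 'M[K]_#|{: F}| :=
  \matrix_(i, j) (a : {malg K[sub_mor G]})@_(elem (pt i) (pt j)).

Definition mx_elt (M : 'M[K]_#|{: F}|) : A :=
  \sum_i \sum_j M i j *: unit_elt (pt i) (pt j).

Lemma mcoeff_mx_elt (M : 'M[K]_#|{: F}|) f :
  (mx_elt M : {malg K[sub_mor G]})@_f
    = \sum_i \sum_j M i j * (f == elem (pt i) (pt j))%:R.
Proof.
rewrite raddf_sum; apply: eq_bigr => i _.
rewrite raddf_sum; apply: eq_bigr => j _.
by rewrite [LHS]mcoeffZ mcoeffU eq_sym; case: (f == _).
Qed.

(** Together with [cols_in], says that a is a matrix indexed by F.  The two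
    conditions are kept apart because a product inherits the first from its left
    factor and the second from its right factor. *)
Definition rows_in (a : A) := forall r s,
  r \notin F -> (a : {malg K[sub_mor G]})@_(elem r s) = 0.

Definition cols_in (a : A) := forall r s,
  s \notin F -> (a : {malg K[sub_mor G]})@_(elem r s) = 0.

Definition supported (a : A) := rows_in a /\ cols_in a.

Lemma mcoeff_mor_mul (f g : sub_mor G) r t :
  (mor_mul K f g)@_(elem r t)
    = ([&& (tag f).2 == (tag g).1, (tag f).1 == r & (tag g).2 == t])%:R.
Proof.
rewrite (mor_elem f) (mor_elem g) mor_mul_elem mcoeffMn mcoeffU elem_eq /=.
by rewrite -mulrnA mulnb andbC.
Qed.

Lemma rows_inM (a b : A) : rows_in a -> rows_in (rngmul a b).
Proof.
move=> ra r t rF; rewrite /rngmul /= /cat_mul mcoeff_bilin.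
apply: big1 => f _; rewrite mulr_sumr big1 // => g _; rewrite mcoeff_mor_mul.
have [defr|_] := eqVneq (tag f).1 r; last by rewrite andbF !mulr0.
by rewrite (mor_elem f) ra ?mul0r // defr.
Qed.

Lemma cols_inM (a b : A) : cols_in b -> cols_in (rngmul a b).
Proof.
move=> cb r t tF; rewrite /rngmul /= /cat_mul mcoeff_bilin.
apply: big1 => f _; rewrite mulr_sumr big1 // => g _; rewrite mcoeff_mor_mul.
have [deft|_] := eqVneq (tag g).2 t; last by rewrite !andbF !mulr0.
by rewrite (mor_elem g) cb ?mul0r ?mulr0 // deft.
Qed.

Lemma mx_eltK : cancel mx_elt coef_mx.
Proof.
move=> M; apply/matrixP=> i j; rewrite mxE mcoeff_mx_elt.
rewrite (bigD1 i) //= (bigD1 j) //= eqxx mulr1 !big1 ?addr0 // => [i' ni|j' nj].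
  apply: big1 => j' _.
  by rewrite elem_eq (inj_eq pt_inj) eq_sym (negPf ni) mulr0.
by rewrite elem_eq !(inj_eq pt_inj) [j == _]eq_sym (negPf nj) andbF mulr0.
Qed.

Lemma mx_elt_supported M : supported (mx_elt M).
Proof.
split=> r s notF; rewrite mcoeff_mx_elt big1 // => i _; apply: big1 => j _.
  by rewrite elem_eq; case: eqP notF => [->|_ _]; rewrite ?pt_in // mulr0.
by rewrite elem_eq andbC; case: eqP notF => [->|_ _]; rewrite ?pt_in // mulr0.
Qed.

Lemma coef_mxK (a : A) : supported a -> mx_elt (coef_mx a) = a.
Proof.
move=> [ra ca]; apply/malgP => f; rewrite (mor_elem f).
have [rM cM] := mx_elt_supported (coef_mx a).
have [rF|rF] := boolP ((tag f).1 \in F); last by rewrite ra // rM.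
have [sF|sF] := boolP ((tag f).2 \in F); last by rewrite ca // cM.
have [i <-] := pt_surj rF; have [j <-] := pt_surj sF.
by have /matrixP/(_ i j) := mx_eltK (coef_mx a); rewrite !mxE.
Qed.

Lemma mx_eltM M N : rngmul (mx_elt M) (mx_elt N) = mx_elt (M *m N).
Proof.
have rowE i j : rngmul (unit_elt (pt i) (pt j)) (mx_elt N)
    = \sum_l N j l *: unit_elt (pt i) (pt l).
  rewrite /rngmul /= /cat_mul bilin_sumr (bigD1 j) //=.
  rewrite [X in _ + X]big1 ?addr0 => [|k nk]; rewrite bilin_sumr.
    apply: eq_bigr => l _; rewrite bilinZr; congr (_ *: _).
    by apply: etrans (unit_eltM _ _ _ _) _; rewrite eqxx.
  apply: big1 => l _; rewrite bilinZr.
  have -> : bilin (@mor_mul K I G)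
      (unit_elt (pt i) (pt j)) (unit_elt (pt k) (pt l)) = 0.
    apply: etrans (unit_eltM _ _ _ _) _.
    by rewrite (inj_eq pt_inj) eq_sym (negPf nk).
  exact: scaler0.
rewrite {1}/mx_elt {1}/rngmul /= /cat_mul bilin_suml; apply: eq_bigr => i _.
rewrite bilin_suml.
transitivity (\sum_j \sum_l (M i j * N j l) *: unit_elt (pt i) (pt l)).
  apply: eq_bigr => j _; rewrite bilinZl.
  have := rowE i j; rewrite {1}/rngmul /= /cat_mul => ->.
  by rewrite scaler_sumr; apply: eq_bigr => l _; rewrite scalerA.
rewrite exchange_big; apply: eq_bigr => l _ /=.
by rewrite mxE scaler_suml.
Qed.

Lemma supported_corner (a : A) :
  supported a -> a = rngmul (rngmul (mx_elt 1%:M) a) (mx_elt 1%:M).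
Proof.
by move=> sa; rewrite -[in RHS](coef_mxK sa) !mx_eltM mul1mx mulmx1 coef_mxK.
Qed.

(** Every element of the corner of e is supported in F like e itself, so its
    matrix over F identifies the corner with a corner of a matrix ring. *)
Lemma supported_idempotent_semisimple (e : idempotent_of A) :
  supported (idem_val e) -> semisimple_ring (corner_ring e).
Proof.
move=> se; pose phi (x : corner_ring e) := coef_mx (corner_val x).
have sx (x : corner_ring e) : supported (corner_val x).
  have /eqP <- := cornerK x; have [re ce] := se.
  by split; [do 2!apply: rows_inM | apply: cols_inM].
have phiM (x y : corner_ring e) : phi (x * y) = phi x *m phi y.
  by rewrite -[RHS]mx_eltK -mx_eltM !coef_mxK.
apply: (@matrix_corner_semisimple K _ _ phi) => // [x y|x y|M].
- by apply/matrixP=> i j; rewrite !mxE mcoeffD.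
- by move=> /(congr1 mx_elt); rewrite !coef_mxK // => /val_inj.
pose a := mx_elt (phi 1 *m M *m phi 1).
have a_corner : a \in corner e.
  have phi11 : phi 1 *m phi 1 = phi 1 by rewrite -phiM mulr1.
  have eE : idem_val e = mx_elt (phi 1) by rewrite coef_mxK.
  apply/eqP; change (rngmul (rngmul (idem_val e) a) (idem_val e) = a).
  rewrite eE !mx_eltM; congr mx_elt.
  by rewrite !mulmxA phi11 -(mulmxA _ (phi 1)) phi11.
by exists (Corner a_corner); rewrite /phi /= mx_eltK.
Qed.

End Matrices.

Lemma supported_finite (s : seq A) :
  exists F, forall a, a \in s -> supported F a.
Proof.
pose objs (p : I * I -> I) : seq I :=
  [seq p (tag f) | a <- s, f <- enum_fset (msupp (a : {malg K[sub_mor G]}))].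
exists [fset r in objs fst ++ objs snd]%fset => a sa.
split=> r t; rewrite !inE; apply: contraNeq; rewrite mcoeff_neq0 => fa.
  by apply/orP; left; apply/allpairsPdep; exists a, (elem r t).
by apply/orP; right; apply/allpairsPdep; exists a, (elem r t).
Qed.

Lemma trivial_locally_semisimple : locally_semisimple A.
Proof.
split=> [s|e].
  have [F sF] := supported_finite s.
  pose u := @mx_elt F 1%:M.
  have uu : rngmul u u = u by rewrite mx_eltM mulmx1.
  exists (Idempotent uu) => a /sF/supported_corner aE.
  by apply/cornerP; exists a.
have [F sF] := supported_finite [:: idem_val e].
by apply: (@supported_idempotent_semisimple F); apply: sF; rewrite mem_head.
Qed.

End TrivialGroups.

(** The only subgroup is the diagonal, so the coefficient there identifies the
    algebra with the 1 x 1 matrices. *)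
Lemma trivial_end_semisimple (K : fieldType) (gG : finGroupType) :
  [set: gG] = [set 1%g] -> semisimple_ring (end_algebra K gG).
Proof.
move=> G1; pose d := diag_subgroup gG.
pose c (a : end_algebra K gG) : K := (a : {malg K[{group (gG * gG)}]})@_d.
have aE (a : end_algebra K gG) : a = c a *: end_one K gG.
  apply/malgP => U; rewrite mcoeffZ mcoeffU.
  have -> : U = d.
    by rewrite (trivial_group_subgroup U) // [RHS]trivial_group_subgroup.
  by rewrite eqxx mulr1.
have cM a b : c (a * b) = c a * c b.
  rewrite {1}(aE a) {1}(aE b) /GRing.mul /= /end_mul.
  rewrite bilinZl bilinZr bilinUU star1U.
  by rewrite /c !mcoeffZ mcoeffUU mulr1.
apply: (@matrix_corner_semisimple K 1 _ (fun a => (c a)%:M)).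
- by move=> a b; rewrite /c mcoeffD raddfD.
- by move=> a b; rewrite cM scalar_mxM.
- move=> a b /matrixP/(_ 0 0); rewrite !mxE !mulr1n => cab.
  by rewrite (aE a) (aE b) cab.
move=> M; exists (M 0 0 *: end_one K gG).
have c1 : c 1 = 1 by rewrite /c mcoeffUU.
by rewrite c1 mul1mx mulmx1 [RHS]mx11_scalar /c mcoeffZ mcoeffUU mulr1.
Qed.

Theorem corollary6p5 (K : fieldType) (charK0 : [pchar K]%R =i pred0)
    (I : choiceType) (I_nonempty : inhabited I) (G : I -> finGroupType) :
  (forall i : I,
     semisimple_ring (end_algebra K (G i)) <-> [set: G i] = [set 1%g]) /\
  (locally_semisimple (category_algebra K G) <->
     forall i : I, [set: G i] = [set 1%g]).
Proof.
split=> [i|]; split.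
- exact: end_algebra_trivial.
- exact: trivial_end_semisimple.
- by move=> [_ ss] i; apply: cat_algebra_trivial ss.
- exact: trivial_locally_semisimple.
Qed.
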